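(* Let $k$ be a positive integer and let $f$ be a continuous $2\pi$-periodic function. Then for every $h\in(0,\pi/k)$, $$W_{2k}^{*}(f,h)\le 3\,\|f\|.$$
   Context: $T=\mathbb{R}/(2\pi\mathbb{Z})$ is the one-dimensional torus and $\|\cdot\|$ is the uniform (sup) norm over $T$. For a positive integer $k$, a continuous function $f$ on $T$, and $t\in\mathbb{R}$, the even central difference is $$\widehat\Delta_t^{2k} f(x)=\sum_{j=-k}^{k}(-1)^j\binom{2k}{k+j} f(x+jt).$$ For $0<h<\pi/k$ let $\phi_h(t)=\frac1h\left(1-\frac{|t|}{h}\right)$ for $t\in[-h,h]$ and $\phi_h(t)=0$ for all other $t\in[-\pi,\pi]$, and define $$W_{2k}(f,x,h)=\binom{2k}{k}^{-1}\int_T \widehat\Delta_t^{2k} f(x)\,\phi_h(t)\,dt=\binom{2k}{k}^{-1}\int_{-h}^{h} \widehat\Delta_t^{2k} f(x)\,\phi_h(t)\,dt .$$ For $0<\delta<\pi/k$ define $$W_{2k}^{\sharp}(f,x,\delta)=\sup_{0<h\le\delta}|W_{2k}(f,x,h)|,\qquad W_{2k}^{*}(f,\delta)=\sup_{x\in T}W_{2k}^{\sharp}(f,x,\delta).$$ *)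

(* Defs.v *)
From mathcomp Require Export all_boot all_order all_algebra.
From mathcomp Require Export all_classical all_reals all_analysis.
Set Implicit Arguments.
Unset Strict Implicit.
Unset Printing Implicit Defensive.
Import Order.TTheory GRing.Theory Num.Theory.
Import numFieldNormedType.Exports.
Local Open Scope classical_set_scope.
Local Open Scope ring_scope.

(* Functions on the torus R / (2 pi Z) are represented by functions f : R -> R
   that are [periodic f (pi *+ 2)]; integrals over the torus are taken over the
   representatives `[- pi, pi].  Suprema are taken in \bar R, so that none of
   them depends on the default value of the real-valued [sup]. *)

Definition unorm (R : realType) (f : R -> R) : \bar R :=
  ereal_sup [set (`|f x|)%:E | x in [set: R]].

(* The index i of the sum stands for k + j, i.e. j = i - k ranges over -k .. k. *)
Definition cdiff (R : realType) (k : nat) (t : R) (f : R -> R) (x : R) : R :=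
  \sum_(i < (2 * k).+1)
    let j : int := i%:Z - k%:Z in
    (-1) ^ j * 'C(2 * k, i)%:R * f (x + j%:~R * t).

Definition phi (R : realType) (h t : R) : R :=
  if t \in `[- h, h] then h^-1 * (1 - `|t| / h) else 0.

Definition W (R : realType) (k : nat) (f : R -> R) (x h : R) : R :=
  ('C(2 * k, k)%:R)^-1 *
  \int[lebesgue_measure]_(t in `[- pi, pi]) (cdiff k t f x * phi h t).

Definition Wsharp (R : realType) (k : nat) (f : R -> R) (x delta : R) : \bar R :=
  ereal_sup [set (`|W k f x h|)%:E | h in [set h : R | 0 < h <= delta]].

Definition Wstar (R : realType) (k : nat) (f : R -> R) (delta : R) : \bar R :=
  ereal_sup [set Wsharp k f x delta | x in [set: R]].

Lemma W_itvNhh (R : realType) (k : nat) (f : R -> R) (x h : R) : h <= pi ->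
  W k f x h = ('C(2 * k, k)%:R)^-1 *
    \int[lebesgue_measure]_(t in `[- h, h])
      (cdiff k t f x * (h^-1 * (1 - `|t| / h))).
Proof.
move=> hpi; rewrite /W; congr (_ * _).
rewrite Rintegral_mkcond [RHS]Rintegral_mkcond.
apply: eq_Rintegral => t _; rewrite /patch !mem_setE /phi.
have [th|th] := boolP (t \in `[- h, h]); last by rewrite mulr0 if_same.
suff -> : t \in `[- pi, pi] by [].
move: th; rewrite !in_itv/= => /andP[h1 h2].
by rewrite (le_trans h2 hpi) andbT (le_trans _ h1)// lerN2.
Qed.

(* Main.v *)
Require Import Defs.
From mathcomp Require Import ring lra zify.
Import Order.TTheory GRing.Theory Num.Theory.
Import numFieldNormedType.Exports.
Local Open Scope classical_set_scope.
Local Open Scope ring_scope.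
Set Implicit Arguments.
Unset Strict Implicit.

(** Write M for the sup norm of f (if it is infinite there is nothing to
    prove), and a_j = C(2k, k + j) / C(2k, k).  Pairing the terms j and - j of
    the difference gives
      W(f, x, h) = f x - 2 * sum_(1 <= j <= k) (-1)^(j - 1) a_j y_j,
    where y_j is the integral of F v = f (x + v) + f (x - v) for v from 0 to
    j h against the half tent (1 - v / (j h)) / (j h).  Integrating by parts
    twice, y_j = g j / j ^ 2 where g is, after rescaling h to 1, the second
    primitive of F that vanishes at 0 together with its derivative
    ([W_expansion]).  As |F| <= 2 M, what remains is
      |sum_j (-1)^(j - 1) a_j y_j| <= M.

    This cannot be done term by term, since sum_j a_j grows like sqrt k; the
    alternation must be used.  The sum is the integral of F against a
    piecewise linear kernel, and the point is to bound the L1 norm of that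
    kernel uniformly in k.

    By Pascal's rule, a_j is a sum of two neighbouring binomial weights of row
    2k - 1, and so on down to row 2k - 3.  Three summations by parts therefore
    replace a_j by the weights r_i = C(2k - 3, k - 2 + i) / C(2k, k)
    ([bin_weight]) and y by its third backward difference.  The r_i are
    nonincreasing, so an Abel summation bounds the sum by r_0 times the
    largest |P_n| with n <= k, where P_n is the alternating sum of the first n
    third differences; no weight depending on k is left in it.  Since r_0 is
    k / (4 (2k - 1)), the bound
      |P_n| <= (4 - 2 / n) * sup |F|   for n >= 2
    is exactly what is needed ([bdiff3_sum_le], [alternating_sum_le]).

    The bounds on P_n are L1 bounds on explicit piecewise linear kernels,
    obtained by the trapezoid rule: on a panel [a, b] where the kernel is
    affine with end values p and q, the integral of |kernel| is at most
    (b - a) (|p| + |q|) / 2.  In terms of g this is Taylor's inequality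
    applied from a to b and from b to a ([taylor2]), so the whole estimate
    becomes algebra on values of g and g'.  For n <= 6 it is a linear
    programming certificate ([head_sum6_le] and its companions).  Beyond, the
    kernel of the j-th third difference has L1 norm of order 1 / j ^ 2 with a
    small constant, and these bounds are summed by telescoping
    ([third_difference_le]).  Summing by parts only once would leave kernels
    of norm 1 / j, whose sum diverges, and stopping after two steps gives the
    order 1 / j ^ 2 with a larger constant. *)

(** * Second primitives and the trapezoid rule *)

(** The algebraic trace of g' = d and |g''| <= B on [0, K].  Keeping only
    this inequality makes the kernel estimates below purely algebraic. *)
Definition taylor2 (R : realFieldType) (K B : R) (g d : R -> R) :=
  forall a b : R, 0 <= a <= K -> 0 <= b <= K ->
  `|g b - g a - d a * (b - a)| <= B / 2 * (b - a) ^+ 2.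

Lemma ler_normM_bound (R : realFieldType) (c u e : R) :
  0 <= c -> `|u| <= e -> - (c * e) <= c * u <= c * e.
Proof. by move=> c0; rewrite ler_norml => /andP[? ?]; nra. Qed.

(** The two expansions across [a, b] are the integrals of g'' against the two
    linear hat functions of the panel.  They are given as four linear
    inequalities so that [lra] can combine panels. *)
Lemma taylor2_panel (R : realFieldType) (K B : R) (g d : R -> R) (a b : R) :
  taylor2 K B g d -> 0 <= a -> a <= b -> b <= K ->
  let r := B / 2 * (b - a) ^+ 2 in
  [/\ - r <= g b - g a - d a * (b - a), g b - g a - d a * (b - a) <= r,
      - r <= g a - g b + d b * (b - a) & g a - g b + d b * (b - a) <= r].
Proof.
move=> gd a0 ab bK r.
have Ia : 0 <= a <= K by rewrite a0 (le_trans ab bK).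
have Ib : 0 <= b <= K by rewrite bK (le_trans a0 ab).
have := gd a b Ia Ib; have := gd b a Ib Ia; rewrite !ler_norml -/r.
rewrite (_ : B / 2 * (a - b) ^+ 2 = r); last by rewrite /r; ring.
by move=> /andP[? ?] /andP[? ?]; split; lra.
Qed.

Lemma taylor2_at1 (R : realFieldType) (K B : R) (g d : R -> R) :
  taylor2 K B g d -> g 0 = 0 -> d 0 = 0 -> 1 <= K -> `|g 1| <= B / 2.
Proof.
move=> gd g0 d0 K1.
have I0 : 0 <= (0 : R) <= K by rewrite lexx (le_trans ler01).
have I1 : 0 <= (1 : R) <= K by rewrite ler01.
by have := gd 0 1 I0 I1; rewrite g0 d0 mul0r !subr0 expr1n mulr1.
Qed.

(** * Kernel bounds for third differences *)

(** With y_j = g j / j ^ 2, this combination is P_2, and the four that follow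
    are P_3, ..., P_6.  Its kernel is piecewise linear with breaks at the
    integers, so any subdivision containing 0, ..., n gives a valid trapezoid
    bound.  For the longer combinations below, where the integers alone do not
    suffice, the extra nodes 5/6, 5/3 and 5/2 sit near the zeros of the
    kernel: the trapezoid rule overestimates |kernel| most on a panel where
    the kernel changes sign. *)
Lemma head_sum2_le (R : realFieldType) (K B : R) (g d : R -> R) :
  taylor2 K B g d -> g 0 = 0 -> d 0 = 0 -> 2 <= K ->
  `|4 * g 1 - g 2 / 4| <= 3 * B.
Proof.
move=> gd g0 d0 Kn.
have h1 := taylor2_panel gd (a := 0) (b := 1)
  ltac:(lra) ltac:(lra) ltac:(lra).
have h2 := taylor2_panel gd (a := 1) (b := 2)
  ltac:(lra) ltac:(lra) ltac:(lra).
rewrite g0 d0 in h1.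
case: h1 => ? ? ? ?; case: h2 => ? ? ? ?.
by rewrite ler_norml; apply/andP; split; lra.
Qed.

Lemma head_sum3_le (R : realFieldType) (K B : R) (g d : R -> R) :
  taylor2 K B g d -> g 0 = 0 -> d 0 = 0 -> 3 <= K ->
  `|7 * g 1 - 4 * (g 2 / 4) + g 3 / 9| <= 10 / 3 * B.
Proof.
move=> gd g0 d0 Kn.
have h1 := taylor2_panel gd (a := 0) (b := 5 / 6)
  ltac:(lra) ltac:(lra) ltac:(lra).
have h2 := taylor2_panel gd (a := 5 / 6) (b := 1)
  ltac:(lra) ltac:(lra) ltac:(lra).
have h3 := taylor2_panel gd (a := 1) (b := 2)
  ltac:(lra) ltac:(lra) ltac:(lra).
have h4 := taylor2_panel gd (a := 2) (b := 3)
  ltac:(lra) ltac:(lra) ltac:(lra).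
rewrite g0 d0 in h1.
case: h1 => ? ? ? ?; case: h2 => ? ? ? ?; case: h3 => ? ? ? ?.
case: h4 => ? ? ? ?.
by rewrite ler_norml; apply/andP; split; lra.
Qed.

Lemma head_sum4_le (R : realFieldType) (K B : R) (g d : R -> R) :
  taylor2 K B g d -> g 0 = 0 -> d 0 = 0 -> 4 <= K ->
  `|8 * g 1 - 7 * (g 2 / 4) + 4 * (g 3 / 9) - g 4 / 16| <= 7 / 2 * B.
Proof.
move=> gd g0 d0 Kn.
have h1 := taylor2_panel gd (a := 0) (b := 5 / 6)
  ltac:(lra) ltac:(lra) ltac:(lra).
have h2 := taylor2_panel gd (a := 5 / 6) (b := 1)
  ltac:(lra) ltac:(lra) ltac:(lra).
have h3 := taylor2_panel gd (a := 1) (b := 5 / 3)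
  ltac:(lra) ltac:(lra) ltac:(lra).
have h4 := taylor2_panel gd (a := 5 / 3) (b := 2)
  ltac:(lra) ltac:(lra) ltac:(lra).
have h5 := taylor2_panel gd (a := 2) (b := 3)
  ltac:(lra) ltac:(lra) ltac:(lra).
have h6 := taylor2_panel gd (a := 3) (b := 4)
  ltac:(lra) ltac:(lra) ltac:(lra).
rewrite g0 d0 in h1.
case: h1 => ? ? ? ?; case: h2 => ? ? ? ?; case: h3 => ? ? ? ?.
case: h4 => ? ? ? ?; case: h5 => ? ? ? ?; case: h6 => ? ? ? ?.
by rewrite ler_norml; apply/andP; split; lra.
Qed.

Lemma head_sum5_le (R : realFieldType) (K B : R) (g d : R -> R) :
  taylor2 K B g d -> g 0 = 0 -> d 0 = 0 -> 5 <= K ->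
  `|8 * g 1 - 8 * (g 2 / 4) + 7 * (g 3 / 9) - 4 * (g 4 / 16)
    + g 5 / 25| <= 18 / 5 * B.
Proof.
move=> gd g0 d0 Kn.
have h1 := taylor2_panel gd (a := 0) (b := 5 / 6)
  ltac:(lra) ltac:(lra) ltac:(lra).
have h2 := taylor2_panel gd (a := 5 / 6) (b := 1)
  ltac:(lra) ltac:(lra) ltac:(lra).
have h3 := taylor2_panel gd (a := 1) (b := 5 / 3)
  ltac:(lra) ltac:(lra) ltac:(lra).
have h4 := taylor2_panel gd (a := 5 / 3) (b := 2)
  ltac:(lra) ltac:(lra) ltac:(lra).
have h5 := taylor2_panel gd (a := 2) (b := 3)
  ltac:(lra) ltac:(lra) ltac:(lra).
have h6 := taylor2_panel gd (a := 3) (b := 4)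
  ltac:(lra) ltac:(lra) ltac:(lra).
have h7 := taylor2_panel gd (a := 4) (b := 5)
  ltac:(lra) ltac:(lra) ltac:(lra).
rewrite g0 d0 in h1.
case: h1 => ? ? ? ?; case: h2 => ? ? ? ?; case: h3 => ? ? ? ?.
case: h4 => ? ? ? ?; case: h5 => ? ? ? ?; case: h6 => ? ? ? ?.
case: h7 => ? ? ? ?.
by rewrite ler_norml; apply/andP; split; lra.
Qed.

Lemma head_sum6_le (R : realFieldType) (K B : R) (g d : R -> R) :
  taylor2 K B g d -> g 0 = 0 -> d 0 = 0 -> 6 <= K ->
  `|8 * g 1 - 8 * (g 2 / 4) + 8 * (g 3 / 9) - 7 * (g 4 / 16)
    + 4 * (g 5 / 25) - g 6 / 36| <= 27 / 8 * B.
Proof.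
move=> gd g0 d0 Kn.
have h1 := taylor2_panel gd (a := 0) (b := 5 / 6)
  ltac:(lra) ltac:(lra) ltac:(lra).
have h2 := taylor2_panel gd (a := 5 / 6) (b := 1)
  ltac:(lra) ltac:(lra) ltac:(lra).
have h3 := taylor2_panel gd (a := 1) (b := 5 / 3)
  ltac:(lra) ltac:(lra) ltac:(lra).
have h4 := taylor2_panel gd (a := 5 / 3) (b := 2)
  ltac:(lra) ltac:(lra) ltac:(lra).
have h5 := taylor2_panel gd (a := 2) (b := 5 / 2)
  ltac:(lra) ltac:(lra) ltac:(lra).
have h6 := taylor2_panel gd (a := 5 / 2) (b := 3)
  ltac:(lra) ltac:(lra) ltac:(lra).
have h7 := taylor2_panel gd (a := 3) (b := 4)
  ltac:(lra) ltac:(lra) ltac:(lra).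
have h8 := taylor2_panel gd (a := 4) (b := 5)
  ltac:(lra) ltac:(lra) ltac:(lra).
have h9 := taylor2_panel gd (a := 5) (b := 6)
  ltac:(lra) ltac:(lra) ltac:(lra).
rewrite g0 d0 in h1.
case: h1 => ? ? ? ?; case: h2 => ? ? ? ?; case: h3 => ? ? ? ?.
case: h4 => ? ? ? ?; case: h5 => ? ? ? ?; case: h6 => ? ? ? ?.
case: h7 => ? ? ? ?; case: h8 => ? ? ? ?; case: h9 => ? ? ? ?.
by rewrite ler_norml; apply/andP; split; lra.
Qed.

(** The kernel of this combination is affine on [0, x - 3] and on the three
    unit panels that follow.  On the first one the slope is a third difference
    of 1 / x ^ 2, hence tiny, so the L1 norm is of order 1 / x ^ 2.  The bound
    is shaped as 1 / (x - 3) - 1 / (x - 2) so that it telescopes. *)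
Lemma third_difference_le (R : realFieldType) (K B x : R) (g d : R -> R) :
  taylor2 K B g d -> g 0 = 0 -> d 0 = 0 -> 0 <= B -> 6 <= x <= K ->
  `|g x / x ^+ 2 - 3 * (g (x - 1) / (x - 1) ^+ 2)
    + 3 * (g (x - 2) / (x - 2) ^+ 2) - g (x - 3) / (x - 3) ^+ 2|
  <= (5 / 2) / ((x - 2) * (x - 3)) * B.
Proof.
move=> gd g0 d0 B0 /andP[x6 xK].
pose e a b := g b - g a - d a * (b - a).
(* The kernel has values - v0, v3, - v2, v1, 0 at 0, x - 3, x - 2, x - 1, x. *)
pose v0 := 6 / (x * (x - 1) * (x - 2) * (x - 3)).
pose v1 := 1 / x ^+ 2.
pose v2 := 3 / (x - 1) ^+ 2 - 2 / x ^+ 2.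
pose v3 := 3 / x ^+ 2 - 6 / (x - 1) ^+ 2 + 3 / (x - 2) ^+ 2.
have nz1 : x != 0 by apply/eqP; lra.
have nz2 : x - 1 != 0 by apply/eqP; lra.
have nz3 : x - 2 != 0 by apply/eqP; lra.
have nz4 : x - 3 != 0 by apply/eqP; lra.
have -> : g x / x ^+ 2 - 3 * (g (x - 1) / (x - 1) ^+ 2)
    + 3 * (g (x - 2) / (x - 2) ^+ 2) - g (x - 3) / (x - 3) ^+ 2
  = - (v0 / (x - 3) * e 0 (x - 3)) + v3 / (x - 3) * e (x - 3) 0
    + v3 * e (x - 3) (x - 2) - v2 * e (x - 2) (x - 3)
    - v2 * e (x - 2) (x - 1) + v1 * e (x - 1) (x - 2) + v1 * e (x - 1) x.
  by rewrite /e g0 d0 /v0 /v1 /v2 /v3; field; rewrite ?nz1 ?nz2 ?nz3 ?nz4.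
have L0 : 0 < x - 3 by lra.
have sq : 0 <= (x - 6) ^+ 2 by exact: sqr_ge0.
have p0 : 0 <= x * (x - 1) * (x - 2) * (x - 3) by rewrite !mulr_ge0//; lra.
have v0p : 0 <= v0 by rewrite /v0 divr_ge0.
have v1p : 0 <= v1 by rewrite /v1 divr_ge0// exprn_ge0//; lra.
have v2p : 0 <= v2.
  have -> : v2 = (x ^+ 2 + 4 * x - 2) / (x ^+ 2 * (x - 1) ^+ 2).
    by rewrite /v2; field; rewrite nz1 nz2.
  rewrite divr_ge0// ?mulr_ge0 ?sqr_ge0//; lra.
have v3p : 0 <= v3.
  have -> : v3 = (18 * x ^+ 2 - 36 * x + 12) /
      (x ^+ 2 * (x - 1) ^+ 2 * (x - 2) ^+ 2).
    by rewrite /v3; field; rewrite nz1 nz2 nz3.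
  rewrite divr_ge0// ?mulr_ge0 ?sqr_ge0//; lra.
have eb (a b : R) : 0 <= a <= K -> 0 <= b <= K ->
    `|e a b| <= B / 2 * (b - a) ^+ 2.
  exact: gd.
have I0 : 0 <= (0 : R) <= K by apply/andP; split; lra.
have I1 : 0 <= x - 1 <= K by apply/andP; split; lra.
have I2 : 0 <= x - 2 <= K by apply/andP; split; lra.
have I3 : 0 <= x - 3 <= K by apply/andP; split; lra.
have Ix : 0 <= x <= K by apply/andP; split; lra.
have q0 : 0 <= v0 / (x - 3) by rewrite divr_ge0// ltW.
have q3 : 0 <= v3 / (x - 3) by rewrite divr_ge0// ltW.
have h1 := ler_normM_bound q0 (eb _ _ I0 I3).
have h2 := ler_normM_bound q3 (eb _ _ I3 I0).
have h3 := ler_normM_bound v3p (eb _ _ I3 I2).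
have h4 := ler_normM_bound v2p (eb _ _ I2 I3).
have h5 := ler_normM_bound v2p (eb _ _ I2 I1).
have h6 := ler_normM_bound v1p (eb _ _ I1 I2).
have h7 := ler_normM_bound v1p (eb _ _ I1 Ix).
(* Half the left-hand side is the trapezoid sum over the four panels. *)
have main : v0 * (x - 3) + v3 * (x - 2) + 2 * v2 + 2 * v1
    <= 5 / ((x - 2) * (x - 3)).
  rewrite -subr_ge0.
  (* Expanding the numerator at x = 6 shows that it is positive. *)
  set y := x - 6.
  have -> : 5 / ((x - 2) * (x - 3))
      - (v0 * (x - 3) + v3 * (x - 2) + 2 * v2 + 2 * v1)
    = (y ^+ 5 + 10 * y ^+ 4 + 33 * y ^+ 3 + 188 * y ^+ 2 + 1244 * y + 2544) /
      (x ^+ 2 * (x - 1) ^+ 2 * (x - 2) ^+ 2 * (x - 3)).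
    by rewrite /v0 /v1 /v2 /v3 /y; field; rewrite ?nz1 ?nz2 ?nz3 ?nz4.
  have y0 : 0 <= y by rewrite /y; lra.
  apply: divr_ge0; last first.
    exact: (mulr_ge0 (mulr_ge0 (mulr_ge0 (sqr_ge0 _) (sqr_ge0 _)) (sqr_ge0 _))
                     (ltW L0)).
  have y2 := exprn_ge0 2 y0; have y3 := exprn_ge0 3 y0.
  have y4 := exprn_ge0 4 y0; have y5 := exprn_ge0 5 y0.
  clearbody y v0 v1 v2 v3; lra.
have mainB : (v0 * (x - 3) + v3 * (x - 2) + 2 * v2 + 2 * v1) * (B / 2)
    <= 5 / 2 / ((x - 2) * (x - 3)) * B.
  rewrite [leRHS](_ : _ = 5 / ((x - 2) * (x - 3)) * (B / 2)).
    by rewrite ler_wpM2r// divr_ge0.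
  by field; rewrite nz3 nz4.
apply: le_trans mainB.
have E1 : v0 / (x - 3) * (B / 2 * (x - 3 - 0) ^+ 2) = v0 * (x - 3) * (B / 2).
  by field; rewrite nz4.
have E2 : v3 / (x - 3) * (B / 2 * (0 - (x - 3)) ^+ 2) = v3 * (x - 3) * (B / 2).
  by field; rewrite nz4.
rewrite E1 in h1; rewrite E2 in h2.
clearbody e v0 v1 v2 v3.
rewrite ler_norml.
move: h1 h2 h3 h4 h5 h6 h7.
do 7! (move=> /andP[? ?]).
by apply/andP; split; lra.
Qed.

(** * Summation by parts *)

(** At 0 the truncated predecessor makes the difference vanish, which is the
    boundary condition needed to sum by parts again. *)
Definition bdiff (R : zmodType) (y : nat -> R) (i : nat) : R := y i - y i.-1.

(** The alternating sums of s i + s i.+1 telescope to +- s, so each use trades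
    one smoothing step of the weights for one difference of y. *)
Lemma alternating_sum_by_parts (R : comNzRingType) (s y : nat -> R) (n : nat) :
  y 0 = 0 -> s n = 0 ->
  \sum_(i < n) (-1) ^+ i * (s i + s i.+1) * y i.+1 =
  \sum_(i < n) (-1) ^+ i * s i * bdiff y i.+1.
Proof.
move=> y0 sn.
suff /(_ n) -> : forall m, \sum_(i < m) (-1) ^+ i * (s i + s i.+1) * y i.+1 =
    \sum_(i < m) (-1) ^+ i * s i * bdiff y i.+1 - (-1) ^+ m * s m * y m.
  by rewrite sn mulr0 mul0r subr0.
elim=> [|m IH]; first by rewrite !big_ord0 y0 mulr0 subr0.
by rewrite !big_ord_recr/= IH /bdiff/= exprS; ring.
Qed.

(** Abel summation: the weighted sum is a combination of the partial sums with
    the nonnegative coefficients r i - r i.+1, of total r 0. *)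
Lemma ler_norm_sum_nonincreasing (R : realFieldType) (r u : nat -> R)
    (n : nat) (C : R) :
  (forall i, (i < n)%N -> r i.+1 <= r i) -> r n = 0 ->
  (forall m, (m <= n)%N -> `|\sum_(i < m) u i| <= C) ->
  `|\sum_(i < n) r i * u i| <= r 0 * C.
Proof.
move=> rS rn uC.
suff /(_ n (leqnn n)) : forall m, (m <= n)%N ->
    `|\sum_(i < m) r i * u i - r m * \sum_(i < m) u i| <= (r 0 - r m) * C.
  by rewrite rn mul0r !subr0.
elim=> [|m IH] mn; first by rewrite !big_ord0 mulr0 !subrr normr0 mul0r.
rewrite (_ : _ - _ = \sum_(i < m) r i * u i - r m * \sum_(i < m) u i
    + (r m - r m.+1) * \sum_(i < m.+1) u i); last first.
  by rewrite !big_ord_recr/=; ring.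
rewrite (_ : (r 0 - r m.+1) * C = (r 0 - r m) * C + (r m - r m.+1) * C);
  last by ring.
apply: (le_trans (ler_normD _ _)); apply: lerD; first exact: IH (ltnW mn).
have rm : 0 <= r m - r m.+1 by rewrite subr_ge0 rS.
by rewrite normrM ger0_norm// ler_wpM2l// uC.
Qed.

(** * Binomial weights three rows above the central coefficient *)

(** With k = n + 2 this is C(2k - 3, k - 2 + i) / C(2k, k); the shift keeps all
    the indices natural, at the price of a separate treatment of k = 1. *)
Definition bin_weight (R : realFieldType) (n i : nat) : R :=
  'C((2 * n).+1, n + i)%:R / 'C(2 * n.+2, n.+2)%:R.

Lemma bin_weight_nonincreasing (R : realFieldType) (n i : nat) :
  bin_weight R n i.+1 <= bin_weight R n i.
Proof.
rewrite /bin_weight ler_wpM2r ?invr_ge0 ?ler0n// ler_nat.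
have := mul_bin_left (2 * n).+1 (n + i).
rewrite addnS => E.
have h : ((2 * n).+1 - (n + i) <= (n + i).+1)%N by lia.
rewrite -(leq_pmul2l (ltn0Sn (n + i))) E.
by rewrite leq_mul2r h orbT.
Qed.

Lemma bin_weight_eq0 (R : realFieldType) (n i : nat) :
  (n.+2 <= i)%N -> bin_weight R n i = 0.
Proof. by move=> ni; rewrite /bin_weight bin_small ?mul0r//; lia. Qed.

Lemma central_bin_third_row (n : nat) :
  ('C(2 * n.+2, n.+2) * n.+2 = 'C((2 * n).+1, n) * (8 * n + 12))%N.
Proof.
have -> : (2 * n.+2 = (2 * n).+1.+3)%N by lia.
have sym : 'C((2 * n).+1, n.+1) = 'C((2 * n).+1, n).
  by rewrite -bin_sub; [congr 'C(_, _)|]; lia.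
have sym3 : 'C((2 * n).+1.+2, n.+1) = 'C((2 * n).+1.+2, n.+2).
  by rewrite -bin_sub; [congr 'C(_, _)|]; lia.
have step := mul_bin_left (2 * n).+1 n.+1.
have E : ((2 * n).+1 - n.+1 = n)%N by lia.
rewrite E sym in step.
move: sym sym3 step; move: (2 * n).+1 => M sym sym3 step.
rewrite binS sym3 !binS sym.
by nia.
Qed.

Lemma bin_weight0 (R : realFieldType) (n : nat) :
  bin_weight R n 0 = n.+2%:R / (4 * (2 * n.+2%:R - 1)).
Proof.
have := central_bin_third_row n; rewrite /bin_weight addn0.
have : (0 < 'C(2 * n.+2, n.+2))%N by rewrite bin_gt0; lia.
move: 'C(_, n.+2) 'C(_, n) => c b c0 /(congr1 (fun m => m%:R : R)).
rewrite !natrM natrD natrM => E.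
have n0 : 0 <= n%:R :> R by rewrite ler0n.
have nE : n.+2%:R = n%:R + 2 :> R by rewrite -natrD addn2.
rewrite nE in E *.
have c0' : c%:R != 0 :> R by rewrite pnatr_eq0 -lt0n.
have d0 : 4 * (2 * (n%:R + 2) - 1) != 0 :> R by apply/eqP; lra.
apply/eqP; rewrite eqr_div//; apply/eqP.
rewrite [RHS]mulrC E; ring.
Qed.

(** Three applications of Pascal's rule, grouped as the nested sums that
    [alternating_sum_by_parts] undoes one layer at a time. *)
Lemma bin_weight_pascal (R : realFieldType) (n i : nat) :
  'C(2 * n.+2, n.+2 + i.+1)%:R / 'C(2 * n.+2, n.+2)%:R =
  (bin_weight R n i + bin_weight R n i.+1)
  + (bin_weight R n i.+1 + bin_weight R n i.+2)
  + ((bin_weight R n i.+1 + bin_weight R n i.+2)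
     + (bin_weight R n i.+2 + bin_weight R n i.+3)).
Proof.
rewrite /bin_weight -!mulrDl -!natrD; congr (_%:R / _).
rewrite (_ : (2 * n.+2 = (2 * n).+1.+3)%N); last by lia.
rewrite (_ : (n.+2 + i.+1 = (n + i).+3)%N); last by lia.
rewrite !addnS; move: (2 * n).+1 (n + i)%N => M m.
by rewrite !binS; lia.
Qed.

(** * Partial sums of third differences *)

(** The integral of g'' against the half tent of width i, when g and g' vanish
    at 0.  The convention 0 / 0 = 0 gives it the value 0 at i = 0. *)
Definition node_value (R : realFieldType) (g : R -> R) (i : nat) : R :=
  g i%:R / i%:R ^+ 2.

Definition bdiff3 (R : realFieldType) (y : nat -> R) (i : nat) : R :=
  bdiff (bdiff (bdiff y)) i.

Lemma bdiff3E (R : realFieldType) (y : nat -> R) (i : nat) :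
  bdiff3 y i = y i - 3 * y i.-1 + 3 * y i.-2 - y i.-2.-1.
Proof. by rewrite /bdiff3 /bdiff; ring. Qed.

(** The value 27 / 8 at n = 6, sharper than 4 - 2 / 6, starts the induction
    that follows. *)
Lemma bdiff3_sum_le6 (R : realFieldType) (n : nat) (K B : R) (g d : R -> R) :
  taylor2 K B g d -> g 0 = 0 -> d 0 = 0 ->
  (1 < n <= 6)%N -> n%:R <= K ->
  `|\sum_(i < n) (-1) ^+ i * bdiff3 (node_value g) i.+1|
    <= (if n == 6%N then 27 / 8 else 4 - 2 / n%:R) * B.
Proof.
move=> gd g0 d0 nI nK.
set y := node_value g.
have y0 : y 0 = 0 by rewrite /y /node_value g0 mul0r.
have y1 : y 1 = g 1 by rewrite /y /node_value expr1n divr1.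
have y2 : y 2 = g 2 / 4 by rewrite /y /node_value -natrX.
have y3 : y 3 = g 3 / 9 by rewrite /y /node_value -natrX.
have y4 : y 4 = g 4 / 16 by rewrite /y /node_value -natrX.
have y5 : y 5 = g 5 / 25 by rewrite /y /node_value -natrX.
have y6 : y 6 = g 6 / 36 by rewrite /y /node_value -natrX.
under eq_bigr do rewrite bdiff3E.
case: n nI nK => [|[|[|[|[|[|[|n]]]]]]]// _ nK;
  rewrite !big_ord_recr big_ord0/= y0.
- have := head_sum2_le gd g0 d0 nK; rewrite -y2 -y1; clear.
  set e := (X in `|X| <= _ -> _); set e' := (X in _ -> `|X| <= _).
  have -> : e' = e by rewrite /e /e'; ring.
  by rewrite (_ : 4 - _ = 3); last by field.
- have := head_sum3_le gd g0 d0 nK; rewrite -y3 -y2 -y1; clear.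
  set e := (X in `|X| <= _ -> _); set e' := (X in _ -> `|X| <= _).
  have -> : e' = e by rewrite /e /e'; ring.
  by rewrite (_ : 4 - _ = 10 / 3); last by field.
- have := head_sum4_le gd g0 d0 nK; rewrite -y4 -y3 -y2 -y1; clear.
  set e := (X in `|X| <= _ -> _); set e' := (X in _ -> `|X| <= _).
  have -> : e' = e by rewrite /e /e'; ring.
  by rewrite (_ : 4 - _ = 7 / 2); last by field.
- have := head_sum5_le gd g0 d0 nK; rewrite -y5 -y4 -y3 -y2 -y1; clear.
  set e := (X in `|X| <= _ -> _); set e' := (X in _ -> `|X| <= _).
  have -> : e' = e by rewrite /e /e'; ring.
  by rewrite (_ : 4 - _ = 18 / 5); last by field.
- have := head_sum6_le gd g0 d0 nK; rewrite -y6 -y5 -y4 -y3 -y2 -y1; clear.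
  set e := (X in `|X| <= _ -> _); set e' := (X in _ -> `|X| <= _).
  by have -> : e' = e by rewrite /e /e'; ring.
Qed.

(** The increments allowed by the right-hand side are exactly those of
    [third_difference_le]. *)
Lemma bdiff3_sum_ge6 (R : realFieldType) (m : nat) (K B : R) (g d : R -> R) :
  taylor2 K B g d -> g 0 = 0 -> d 0 = 0 -> 0 <= B -> (m + 6)%:R <= K ->
  `|\sum_(i < m + 6) (-1) ^+ i * bdiff3 (node_value g) i.+1|
    <= (4 - (5 / 2) / (m%:R + 4)) * B.
Proof.
move=> gd g0 d0 B0; elim: m => [|m IH] mK.
  apply: le_trans (bdiff3_sum_le6 gd g0 d0 _ mK) _ => //=.
  by rewrite add0r (_ : 4 - _ = 27 / 8); last by field.
have m0 : 0 <= m%:R :> R by rewrite ler0n.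
have mE : (m.+1 + 6)%:R = m%:R + 7 :> R by rewrite natrD -natr1; ring.
have mK' : (m + 6)%:R <= K by apply: le_trans mK; rewrite ler_nat; lia.
have xI : 6 <= (m%:R + 7 : R) <= K.
  by rewrite -mE mK andbT mE; lra.
have := third_difference_le gd g0 d0 B0 xI.
have E7 : m%:R + 7 = (m + 7)%:R :> R by rewrite natrD.
have E6 : m%:R + 7 - 1 = (m + 6)%:R :> R by rewrite natrD; ring.
have E5 : m%:R + 7 - 2 = (m + 5)%:R :> R by rewrite natrD; ring.
have E4 : m%:R + 7 - 3 = (m + 4)%:R :> R by rewrite natrD; ring.
rewrite (_ : (m%:R + 7 - 2) * (m%:R + 7 - 3) = (m%:R + 5) * (m%:R + 4));
  last by ring.
rewrite E4 E5 E6 E7 !addnS addn0 => tl.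
have {}IH := IH mK'.
rewrite !addnS addn0 in IH; rewrite addSn big_ord_recr/= addn0.
apply: (le_trans (ler_normD _ _)).
have -> : (4 - 5 / 2 / (m.+1%:R + 4)) * B =
    (4 - 5 / 2 / (m%:R + 4)) * B + 5 / 2 / ((m%:R + 5) * (m%:R + 4)) * B.
  rewrite -natr1; field.
  by apply/andP; split; apply/eqP; lra.
apply: lerD => //.
rewrite normrM normrX normrN1 expr1n mul1r.
apply: le_trans tl; rewrite le_eqVlt; apply/orP; left; apply/eqP; congr `|_|.
rewrite bdiff3E /node_value/=.
set y1 := g _ / _; set y2 := g _ / _; set y3 := g _ / _; set y4 := g _ / _.
by ring.
Qed.

Lemma bdiff3_sum_le (R : realFieldType) (n : nat) (K B : R) (g d : R -> R) :
  taylor2 K B g d -> g 0 = 0 -> d 0 = 0 -> 0 <= B -> (1 < n)%N -> n%:R <= K ->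
  `|\sum_(i < n) (-1) ^+ i * bdiff3 (node_value g) i.+1|
    <= (4 - 2 / n%:R) * B.
Proof.
move=> gd g0 d0 B0 n1 nK.
have [n6|n6] := ltnP n 6; last first.
  have nE : n = (n - 6 + 6)%N by lia.
  rewrite nE in nK *; move: (n - 6)%N nK => m mK.
  apply: le_trans (bdiff3_sum_ge6 gd g0 d0 B0 mK) _.
  rewrite ler_wpM2r// natrD lerD2l lerN2.
  have m0 : 0 <= m%:R :> R by rewrite ler0n.
  rewrite ler_pdivrMr; last by lra.
  by rewrite mulrAC ler_pdivlMr; lra.
apply: le_trans (bdiff3_sum_le6 gd g0 d0 _ nK) _; first by rewrite n1 ltnW.
by rewrite ltn_eqF.
Qed.

(** For k >= 2 the estimate closes with equality in the constants:
    r_0 * (4 - 2 / k) = 1 / 2. *)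
Lemma alternating_sum_le (R : realFieldType) (k : nat) (B : R)
    (g d : R -> R) :
  taylor2 k%:R B g d -> g 0 = 0 -> d 0 = 0 -> 0 <= B -> (0 < k)%N ->
  `|\sum_(i < k) (-1) ^+ i * ('C(2 * k, k + i.+1)%:R / 'C(2 * k, k)%:R)
     * node_value g i.+1| <= B / 2.
Proof.
case: k => [//|[|n]] gd g0 d0 B0 _.
  rewrite big_ord1 expr0 mul1r /node_value expr1n divr1.
  have g1 := taylor2_at1 gd g0 d0 (lexx _).
  rewrite (_ : 'C(2 * 1, 1) = 2)// (_ : 'C(2 * 1, 1 + 1) = 1)//.
  have := normr_ge0 (g 1).
  rewrite normrM ger0_norm; last by rewrite divr_ge0.
  lra.
set k := n.+2; set y := node_value g.
have y0 : y 0 = 0 by rewrite /y /node_value g0 mul0r.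
have bw0 i : (k <= i)%N -> bin_weight R n i = 0 by exact: bin_weight_eq0.
rewrite (_ : \sum_(i < k) _ =
    \sum_(i < k) bin_weight R n i * ((-1) ^+ i * bdiff3 y i.+1)).
  apply: le_trans (ler_norm_sum_nonincreasing (r := bin_weight R n)
    (u := fun i => (-1) ^+ i * bdiff3 y i.+1) (C := (4 - 2 / k%:R) * B)
    _ _ _) _.
  - by move=> i _; exact: bin_weight_nonincreasing.
  - exact: bw0.
  - move=> m mk.
    have le2 : 2 / k%:R <= 1 :> R.
      by rewrite ler_pdivrMr ?mul1r ?ler_nat ?ltr0n.
    case: m mk => [_|[_|m mk]].
    + by rewrite big_ord0 normr0 mulr_ge0//; lra.
    + have k1 : 1 <= k%:R :> R by rewrite ler1n.
      have g1 := taylor2_at1 gd g0 d0 k1.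
      rewrite big_ord1 expr0 mul1r bdiff3E/= y0 !mulr0 addr0 !subr0.
      rewrite /y /node_value expr1n divr1; nra.
    + have mR : m.+2%:R <= k%:R :> R by rewrite ler_nat.
      apply: le_trans (bdiff3_sum_le gd g0 d0 B0 _ mR) _ => //.
      rewrite ler_wpM2r// lerD2l lerN2 ler_wpM2l// lef_pV2// posrE ltr0n//.
  - rewrite bin_weight0 -/k.
    have k2 : 2 <= k%:R :> R by rewrite ler_nat.
    rewrite le_eqVlt; apply/orP; left; apply/eqP; field.
    by apply/andP; split; apply/eqP; lra.
under eq_bigr do rewrite bin_weight_pascal.
pose s1 i := bin_weight R n i + bin_weight R n i.+1.
pose s2 i := s1 i + s1 i.+1.
rewrite (alternating_sum_by_parts (s := s2))//; last first.
  by rewrite /s2 /s1 !bw0 ?addr0//; lia.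
rewrite (alternating_sum_by_parts (s := s1) (y := bdiff y)); last 2 first.
- exact: subrr.
- by rewrite /s1 !bw0 ?addr0//; lia.
rewrite (alternating_sum_by_parts (y := bdiff (bdiff y))); last 2 first.
- exact: subrr.
- exact: bw0.
by apply: eq_bigr => i _; rewrite [RHS]mulrCA mulrA.
Qed.

(** * Primitives and tent averages *)

Lemma is_derive_continuous (R : realType) (F : R -> R) (t l : R) :
  is_derive t 1 F l -> {for t, continuous F}.
Proof. by case=> dF _; exact/differentiable_continuous/derivable1_diffP. Qed.

Lemma integrable_itv_continuous (R : realType) (a b : R) (u : R -> R) :
  continuous u -> (@lebesgue_measure R).-integrable `[a, b] (EFin \o u).
Proof.
move=> cu; apply: continuous_compact_integrable; first exact: segment_compact.
exact: continuous_subspaceT.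
Qed.

Lemma continuous_tentM (R : realType) (u : R -> R) (h : R) :
  continuous u -> continuous (fun t : R => u t * (h^-1 * (1 - `|t| / h))).
Proof.
move=> cu t; apply: cvgM; first exact: cu.
apply: cvgM; first exact: cvg_cst.
apply: cvgB; first exact: cvg_cst.
by apply: cvgM; [exact: norm_continuous|exact: cvg_cst].
Qed.

Lemma continuous_affine_arg (R : realType) (f : R -> R) (x c : R) :
  continuous f -> continuous (fun t : R => f (x + c * t)).
Proof.
move=> cf t.
apply: (@continuous_comp _ _ _ (fun t : R => x + c * t)); last exact: cf.
apply: cvgD; first exact: cvg_cst.
by apply: cvgM; [exact: cvg_cst|exact: cvg_id].
Qed.

(** The integral starts at - A rather than at 0 because the fundamental theorem
    differentiates it only to the right of its base point. *)
Lemma primitive_ex (R : realType) (f : R -> R) (A : R) :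
  (forall t : R, `|t| <= A -> {for t, continuous f}) ->
  exists2 F : R -> R, F 0 = 0 & forall t : R, `|t| < A -> is_derive t 1 F (f t).
Proof.
move=> cf.
have fi : (@lebesgue_measure R).-integrable `[- A, A] (EFin \o f).
  apply: continuous_compact_integrable; first exact: segment_compact.
  apply: continuous_in_subspaceT => t; rewrite inE/= in_itv/= -ler_norml.
  exact: cf.
pose F t := \int[lebesgue_measure]_(s in `[- A, t]) f s.
exists (fun t => F t - F 0) => [|t tA]; first by rewrite subrr.
have /andP[At tA'] : - A < t < A by rewrite -ltr_norml.
have [dF F'] := continuous_FTC1_closed tA' fi At (cf t (ltW tA)).
have HF : is_derive t 1 F (f t).
  by apply: (DeriveDef dF); rewrite -derive1E; exact: F'.
by apply: is_derive_eq; rewrite subr0.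
Qed.

Lemma second_primitive_ex (R : realType) (u : R -> R) (A : R) :
  continuous u ->
  exists D G : R -> R, [/\ D 0 = 0, G 0 = 0,
    (forall t : R, `|t| < A -> is_derive t 1 D (u t)) &
    (forall t : R, `|t| < A -> is_derive t 1 G (D t))].
Proof.
move=> cu.
have [D D0 D'] := @primitive_ex R u (A + 1) (fun t _ => cu t).
have lt1 (t : R) : `|t| <= A -> `|t| < A + 1.
  by move=> tA; rewrite (le_lt_trans tA)// ltrDl.
have cD (t : R) : `|t| <= A -> {for t, continuous D}.
  by move=> /lt1/D'/is_derive_continuous.
have [G G0 G'] := primitive_ex cD.
by exists D, G; split => // t tA; apply/D'/lt1/ltW.
Qed.

(** The endpoints come in either order, so that c lying between them is
    expressed by the sign of a product. *)
Lemma MVT_norm_lt (R : realType) (F dF : R -> R) (A a b : R) :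
  (forall t : R, `|t| < A -> is_derive t 1 F (dF t)) ->
  `|a| < A -> `|b| < A ->
  exists c, [/\ `|c| < A, 0 <= (c - a) * (b - c) &
                F b - F a = dF c * (b - a)].
Proof.
move=> F'.
wlog ab : a b / a <= b.
  move=> H aA bA; have [ab|/ltW ba] := leP a b; first exact: H.
  have [c [cA cab E]] := H b a ba bA aA.
  exists c; split=> //; last by rewrite -opprB E; ring.
  by rewrite (_ : _ * _ = (c - b) * (a - c))//; ring.
rewrite !ltr_norml => /andP[Aa aA] /andP[Ab bA].
have HF (t : R) : t \in `[a, b] -> is_derive t 1 F (dF t).
  rewrite in_itv/= => /andP[a_t tb]; apply: F'.
  by rewrite ltr_norml (lt_le_trans Aa a_t) (le_lt_trans tb bA).
have dFoo (t : R) : t \in `]a, b[%R -> is_derive t 1 F (dF t).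
  by move=> tab; apply: HF; exact: subset_itv_oo_cc tab.
have cF : {within `[a, b], continuous F}.
  apply: continuous_in_subspaceT => t; rewrite inE => /HF.
  exact: is_derive_continuous.
have [c cab E] := MVT_segment ab dFoo cF.
exists c; move: cab; rewrite in_itv/= => /andP[ac cb]; split => //.
  by rewrite ltr_norml (lt_le_trans Aa ac) (le_lt_trans cb bA).
by rewrite mulr_ge0// subr_ge0.
Qed.

(** Taylor's inequality for V'' = u.  Since V'' exists everywhere, one mean
    value step for V' and one for V minus the extremal parabola give the sharp
    factor 1 / 2. *)
Lemma second_primitive_taylor (R : realType) (u U V : R -> R) (A M a b : R) :
  (forall t : R, `|t| < A -> is_derive t 1 U (u t)) ->
  (forall t : R, `|t| < A -> is_derive t 1 V (U t)) ->
  (forall t, `|u t| <= M) -> `|a| < A -> `|b| < A ->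
  `|V b - V a - U a * (b - a)| <= M / 2 * (b - a) ^+ 2.
Proof.
move=> U' V' uM aA bA.
have lipU c : `|c| < A -> `|U c - U a| <= M * `|c - a|.
  move=> cA; have [e [_ _ ->]] := MVT_norm_lt U' aA cA.
  by rewrite normrM ler_wpM2r.
have key (s : R) : s ^+ 2 = 1 ->
    s * (V b - V a - U a * (b - a)) <= M / 2 * (b - a) ^+ 2.
  move=> s2.
  (* psi vanishes at a, increases before it and decreases after it. *)
  pose psi (t : R) := s * (V t - U a * (t - a)) - M / 2 * (t - a) ^+ 2.
  have psi' (t : R) : `|t| < A ->
      is_derive t 1 psi (s * (U t - U a) - M * (t - a)).
    move=> tA; have ? := V' t tA.
    apply: is_derive_eq.
    by rewrite /GRing.scale/=; field.
  have [c [cA cab]] := MVT_norm_lt psi' aA bA.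
  rewrite /psi !subrr mulr0 expr0n/= mulr0 !subr0 => E.
  have lip := lipU c cA.
  suff : (s * (U c - U a) - M * (c - a)) * (b - a) <= 0 by lra.
  have cb : 0 <= (c - a) * (b - a).
    rewrite (_ : _ * _ = (c - a) * (b - c) + (c - a) ^+ 2); last by ring.
    by rewrite addr_ge0// sqr_ge0.
  have s1 : `|s| = 1.
    by apply/eqP; rewrite -(@eqrXn2 _ 2)// -normrX s2 expr1n normr1.
  rewrite mulrBl subr_le0.
  apply: (le_trans (ler_norm _)); rewrite !normrM s1 mul1r.
  rewrite -mulrA -(ger0_norm cb) normrM.
  by rewrite mulrA ler_wpM2r.
rewrite ler_norml; have := key 1; have := key (-1).
by rewrite sqrrN expr1n => /(_ erefl) ? /(_ erefl) ?; apply/andP; split; lra.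
Qed.

(** The tent is the Peano kernel of the central second difference. *)
Lemma tent_average (R : realType) (u U V : R -> R) (A h : R) :
  continuous u ->
  (forall t : R, `|t| < A -> is_derive t 1 U (u t)) ->
  (forall t : R, `|t| < A -> is_derive t 1 V (U t)) ->
  0 < h -> h < A ->
  \int[lebesgue_measure]_(t in `[- h, h]) (u t * (h^-1 * (1 - `|t| / h)))
  = (V h - 2 * V 0 + V (- h)) / h ^+ 2.
Proof.
move=> cu U' V' h0 hA.
have hn0 : h != 0 by rewrite gt_eqF.
pose w (t : R) := u t * (h^-1 * (1 - `|t| / h)).
have cw : continuous w by exact: continuous_tentM.
have iw (a b : R) := integrable_itv_continuous a b cw.
(* On each side of 0, where `|t| = s * t, integrate by parts twice. *)
have half (s a b : R) : s = 1 \/ s = -1 -> a < b -> - h <= a -> b <= h ->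
    {in `[a, b], forall t, `|t| = s * t} ->
    \int[lebesgue_measure]_(t in `[a, b]) w t =
    (U b * (h^-1 * (1 - s * b / h)) + s * V b / h ^+ 2)
    - (U a * (h^-1 * (1 - s * a / h)) + s * V a / h ^+ 2).
  move=> s1 ab ha bh abs.
  pose E (t : R) := U t * (h^-1 * (1 - s * t / h)) + s * V t / h ^+ 2.
  have tA t : t \in `[a, b] -> `|t| < A.
    rewrite in_itv/= => /andP[a_t tb]; rewrite ltr_norml.
    by apply/andP; split; lra.
  have E' (t : R) : t \in `[a, b] -> is_derive t 1 E (w t).
    move=> tab; have ? := U' t (tA t tab); have ? := V' t (tA t tab).
    apply: is_derive_eq.
    by rewrite /w abs// /GRing.scale/=; field.
  have Ec (t : R) : t \in `[a, b] -> {for t, continuous E}.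
    by move=> /E'/is_derive_continuous.
  rewrite /Rintegral (@continuous_FTC2 _ w E)//.
  - exact: continuous_subspaceT.
  - split => [t /subset_itv_oo_cc/E'[] //| |].
    + by apply: cvg_at_right_filter; apply: Ec; rewrite in_itv/= lexx ltW.
    + by apply: cvg_at_left_filter; apply: Ec; rewrite in_itv/= lexx ltW.
  - by move=> t /subset_itv_oo_cc/E'[_ <-]; rewrite derive1E.
have -> : \int[lebesgue_measure]_(t in `[- h, h]) w t =
    \int[lebesgue_measure]_(t in `[- h, 0]) w t +
    \int[lebesgue_measure]_(t in `[0, h]) w t.
  rewrite -[X in _ + X]Rintegral_itv_obnd_cbnd; last first.
    by apply: integrableS (iw 0 h) => //; exact: subset_itv_oc_cc.
  by rewrite -(@Rintegral_itvB _ w (BLeft (- h)) (BRight h) 0) ?bnd_simp;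
    [rewrite addrC subrK|exact: iw|lra|lra].
have absN : {in `[- h, 0], forall t : R, `|t| = -1 * t}.
  by move=> t; rewrite in_itv/= => /andP[_ t0]; rewrite ler0_norm// mulN1r.
have absP : {in `[0, h], forall t : R, `|t| = 1 * t}.
  by move=> t; rewrite in_itv/= => /andP[t0 _]; rewrite ger0_norm// mul1r.
rewrite (half _ _ _ (or_intror erefl) _ _ _ absN); [|lra..].
rewrite (half _ _ _ (or_introl erefl) _ _ _ absP); [|lra..].
by field.
Qed.

Lemma is_derive_scale (R : realType) (F : R -> R) (c t l : R) :
  is_derive (c * t) 1 F l -> is_derive t 1 (fun s => F (c * s)) (c * l).
Proof.
move=> F'; have cid : is_derive t 1 (fun s : R => c * s) c.
  by apply: is_derive_eq; rewrite /GRing.scale/= mulr1.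
have := is_derive1_comp F' cid.
by rewrite mulrC.
Qed.

Lemma is_derive_dilation (R : realType) (F : R -> R) (c l t : R) :
  c != 0 -> is_derive (c * t) 1 F l ->
  is_derive t 1 (fun s => F (c * s) / c) l.
Proof.
move=> c0 F'; have ? := is_derive_scale F'.
apply: is_derive_eq; rewrite /GRing.scale/=; field => //.
Qed.

Lemma tent_average_dilation (R : realType) (f D G : R -> R) (x c h A : R) :
  continuous f -> D 0 = 0 -> G 0 = 0 ->
  (forall t : R, `|t| < A -> is_derive t 1 D (f (x + t))) ->
  (forall t : R, `|t| < A -> is_derive t 1 G (D t)) ->
  c != 0 -> 0 < h -> `|c| * (h + 1) <= A ->
  \int[lebesgue_measure]_(t in `[- h, h])
     (f (x + c * t) * (h^-1 * (1 - `|t| / h)))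
  = (G (c * h) + G (- (c * h))) / (c * h) ^+ 2.
Proof.
move=> cf D0 G0 D' G' c0 h0 cA.
have cu := continuous_affine_arg (x := x) (c := c) cf.
have ctA t : `|t| < h + 1 -> `|c * t| < A.
  move=> th; apply: lt_le_trans cA.
  by rewrite normrM ltr_pM2l// normr_gt0.
have HU (t : R) : `|t| < h + 1 ->
    is_derive t 1 (fun s => D (c * s) / c) (f (x + c * t)).
  by move=> th; exact: is_derive_dilation (D' _ (ctA t th)).
have HV (t : R) : `|t| < h + 1 ->
    is_derive t 1 (fun s => G (c * s) / c / c) (D (c * t) / c).
  move=> th; have Gt := is_derive_dilation c0 (G' _ (ctA t th)).
  by apply: is_derive_eq; rewrite scaler0 add0r /GRing.scale/= mulrC.
have h1 : h < h + 1 by rewrite ltrDl.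
rewrite (tent_average cu HU HV h0 h1) mulr0 G0 mulrN; field.
by rewrite c0 gt_eqF.
Qed.

Lemma tent_average_cst (R : realType) (y h : R) : 0 < h ->
  \int[lebesgue_measure]_(t in `[- h, h]) (y * (h^-1 * (1 - `|t| / h))) = y.
Proof.
move=> h0.
have cu : continuous (fun _ : R => y) by exact: cst_continuous.
have HU (t : R) : `|t| < h + 1 -> is_derive t 1 (fun s => y * s) y.
  by move=> _; apply: is_derive_eq; rewrite /GRing.scale/= mulr1.
have HV (t : R) : `|t| < h + 1 ->
    is_derive t 1 (fun s => y / 2 * s ^+ 2) (y * t).
  by move=> _; apply: is_derive_eq; rewrite /GRing.scale/=; field.
have h1 : h < h + 1 by rewrite ltrDl.
rewrite (tent_average cu HU HV h0 h1); field.
by rewrite gt_eqF.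
Qed.

(** * The tent average of a central difference *)

Lemma sum_around_middle (R : zmodType) (F : nat -> R) (k : nat) :
  \sum_(i < (2 * k).+1) F i =
  F k + \sum_(i < k) (F (k + i.+1)%N + F (k - i.+1)%N).
Proof.
rewrite -(big_mkord xpredT F) (big_cat_nat (n := k))//=; last by lia.
rewrite big_nat_rev/= [X in _ + X]big_ltn; last by lia.
rewrite addrCA; congr (_ + _).
rewrite big_mkord addrC big_split/=; congr (_ + _).
rewrite -{1}(add1n k) big_addn (_ : (_ - k = k.+1)%N); last by lia.
rewrite big_add1/= big_mkord.
by apply: eq_bigr => i _; congr F; lia.
Qed.

Lemma sum_continuous (R : realType) (n : nat) (u : 'I_n -> R -> R) :
  (forall i, continuous (u i)) -> continuous (fun t => \sum_(i < n) u i t).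
Proof.
elim: n u => [|n IH] u cu t.
  by under eq_fun do rewrite big_ord0; exact: cvg_cst.
by under eq_fun do rewrite big_ord_recr/=; apply: cvgD; [exact: IH|exact: cu].
Qed.

Lemma Rintegral_sum_continuous (R : realType) (a b : R) (n : nat)
    (u : 'I_n -> R -> R) :
  (forall i, continuous (u i)) ->
  \int[lebesgue_measure]_(t in `[a, b]) (\sum_(i < n) u i t) =
  \sum_(i < n) \int[lebesgue_measure]_(t in `[a, b]) u i t.
Proof.
elim: n u => [|n IH] u cu.
  under eq_Rintegral do rewrite big_ord0.
  by rewrite big_ord0 Rintegral_cst// mul0r.
under eq_Rintegral do rewrite big_ord_recr/=.
rewrite RintegralD//; last 2 first.
- exact/integrable_itv_continuous/sum_continuous.
- exact/integrable_itv_continuous/cu.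
by rewrite IH ?big_ord_recr.
Qed.

Lemma expN1_intB (R : fieldType) (i k : nat) :
  (-1 : R) ^ (i%:Z - k%:Z) = (-1) ^+ i * (-1) ^+ k.
Proof.
by rewrite expfzDr ?oppr_eq0 ?oner_eq0// -exprnN invr_sign.
Qed.

Lemma W_tent_sum (R : realType) (k : nat) (f : R -> R) (x h : R) :
  continuous f -> h <= pi ->
  W k f x h = ('C(2 * k, k)%:R)^-1 * \sum_(i < (2 * k).+1)
    (-1) ^+ i * (-1) ^+ k * 'C(2 * k, i)%:R *
    \int[lebesgue_measure]_(t in `[- h, h])
      (f (x + (i%:R - k%:R) * t) * (h^-1 * (1 - `|t| / h))).
Proof.
move=> cf hpi; rewrite W_itvNhh//; congr (_ * _).
pose u (i : 'I_(2 * k).+1) (t : R) := (-1) ^+ i * (-1) ^+ k * 'C(2 * k, i)%:R *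
  (f (x + (i%:R - k%:R) * t) * (h^-1 * (1 - `|t| / h))).
have cv (i : 'I_(2 * k).+1) :
    continuous (fun t : R =>
      f (x + (i%:R - k%:R) * t) * (h^-1 * (1 - `|t| / h))).
  exact/continuous_tentM/continuous_affine_arg.
transitivity (\int[lebesgue_measure]_(t in `[- h, h]) \sum_i u i t).
  apply: eq_Rintegral => t _; rewrite /cdiff mulr_suml.
  apply: eq_bigr => i _.
  by rewrite expN1_intB rmorphB/= /u !mulrA.
rewrite Rintegral_sum_continuous; last first.
  by move=> i t; apply: cvgM; [exact: cvg_cst|exact: cv].
apply: eq_bigr => i _; rewrite RintegralZl//.
exact: integrable_itv_continuous.
Qed.

(** The terms j and - j contribute g j / j ^ 2 together, where g s is (G (h s)
    + G (- h s)) / h ^ 2 for a second primitive G of f (x + .), so that g'' s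
    = f (x + h s) + f (x - h s). *)
Lemma W_expansion (R : realType) (k : nat) (f : R -> R) (x h M : R) :
  continuous f -> (forall t, `|f t| <= M) -> 0 < h -> h <= pi ->
  exists g d : R -> R, [/\ taylor2 k%:R (2 * M) g d, g 0 = 0, d 0 = 0 &
    W k f x h = f x - 2 * \sum_(i < k) (-1) ^+ i *
      ('C(2 * k, k + i.+1)%:R / 'C(2 * k, k)%:R) * node_value g i.+1].
Proof.
move=> cf fM h0 hpi.
have hn0 : h != 0 by rewrite gt_eqF.
(* Room for the points j * h with `|j| <= k, and a margin to differentiate. *)
pose A := (k%:R + 1) * (h + 1).
have cu : continuous (fun t : R => f (x + t)).
  by under eq_fun do rewrite -[X in _ + X]mul1r; exact: continuous_affine_arg.
have [D [G [D0 G0 D' G']]] := second_primitive_ex A cu.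
exists (fun s => (G (h * s) + G (- (h * s))) / h ^+ 2).
exists (fun s => (D (h * s) - D (- (h * s))) / h).
split; last first.
- rewrite W_tent_sum// (sum_around_middle (fun i => (-1) ^+ i * (-1) ^+ k *
    'C(2 * k, i)%:R * \int[lebesgue_measure]_(t in `[- h, h])
      (f (x + (i%:R - k%:R) * t) * (h^-1 * (1 - `|t| / h))))).
  have Ck0 : 'C(2 * k, k)%:R != 0 :> R.
    by rewrite pnatr_eq0 -lt0n bin_gt0; lia.
  have s2 j : (-1) ^+ j * (-1) ^+ j = 1 :> R by rewrite -expr2 sqrr_sign.
  under eq_Rintegral do rewrite subrr mul0r addr0.
  rewrite tent_average_cst// s2 mul1r mulrDr mulKf//; congr (_ + _).
  rewrite -mulrN -sumrN !mulr_sumr; apply: eq_bigr => i _.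
  have ci : i.+1%:R != 0 :> R by rewrite pnatr_eq0.
  have cA (c : R) : `|c| = i.+1%:R -> `|c| * (h + 1) <= A.
    move=> ->; rewrite ler_wpM2r ?addr_ge0 ?ltW//.
    by apply: (@lt_le_trans _ _ (i.+1%:R + 1)); rewrite ?ltrDl ?lerD2r ?ler_nat.
  have ik : (i.+1 <= k)%N by [].
  have bsym : 'C(2 * k, k - i.+1) = 'C(2 * k, k + i.+1).
    by rewrite -bin_sub; [congr 'C(_, _)|]; lia.
  have sgn : (-1) ^+ (k - i.+1) = (-1) ^+ (k + i.+1) :> R.
    by rewrite -signr_odd -[RHS]signr_odd oddB// oddD.
  have e1 : (k + i.+1)%:R - k%:R = i.+1%:R :> R by rewrite natrD; ring.
  have e2 : (k - i.+1)%:R - k%:R = - i.+1%:R :> R by rewrite natrB//; ring.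
  rewrite bsym sgn e1 e2.
  have ciN : - i.+1%:R != 0 :> R by rewrite oppr_eq0.
  have nP : `|i.+1%:R| = i.+1%:R :> R by rewrite normr_nat.
  have nN : `|- i.+1%:R| = i.+1%:R :> R by rewrite normrN.
  rewrite (tent_average_dilation cf D0 G0 D' G' ciN h0 (cA _ nN)).
  rewrite (tent_average_dilation cf D0 G0 D' G' ci h0 (cA _ nP)).
  have -> : (-1) ^+ (k + i.+1) * (-1) ^+ k = - (-1) ^+ i :> R.
    by rewrite exprD mulrAC s2 mul1r exprS mulN1r.
  rewrite /node_value [h * _]mulrC (mulNr i.+1%:R) opprK.
  by field; rewrite nat1r ci hn0 Ck0.
- by rewrite mulr0 oppr0 subrr mul0r.
- by rewrite mulr0 oppr0 G0 addr0 mul0r.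
- move=> a b /andP[a0 ak] /andP[b0 bk].
  have hA (c : R) : 0 <= c -> c <= k%:R -> `|h * c| < A.
    move=> c0 ck; rewrite ger0_norm; last by rewrite mulr_ge0// ltW.
    by rewrite /A; nra.
  have ha := hA a a0 ak; have hb := hA b b0 bk.
  have fxM (t : R) : `|f (x + t)| <= M by [].
  have T1 := second_primitive_taylor D' G' fxM ha hb.
  have T2 : `|G (- (h * b)) - G (- (h * a)) - D (- (h * a)) *
      (- (h * b) - - (h * a))| <= M / 2 * (- (h * b) - - (h * a)) ^+ 2.
    by apply: (second_primitive_taylor D' G' fxM); rewrite normrN.
  rewrite (_ : _ - _ - _ =
    ((G (h * b) - G (h * a) - D (h * a) * (h * b - h * a)) +
      (G (- (h * b)) - G (- (h * a)) - D (- (h * a)) *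
      (- (h * b) - - (h * a)))) / h ^+ 2); last by field.
  rewrite normrM normfV [`|h ^+ 2|]ger0_norm ?sqr_ge0//.
  rewrite ler_pdivrMr ?exprn_gt0//.
  apply: (le_trans (ler_normD _ _)); apply: le_trans (lerD T1 T2) _.
  by rewrite le_eqVlt; apply/orP; left; apply/eqP; field.
Qed.

Theorem lemma1 (R : realType) (k : nat) (hk : (0 < k)%N)
    (f : R -> R) (f_cont : continuous f) (f_per : periodic f (pi *+ 2))
    (h : R) (h_gt0 : 0 < h) (h_lt : h < pi / k%:R) :
  (Wstar k f h <= 3%:E * unorm f)%E.
Proof.
have fx_le x : (`|f x|%:E <= unorm f)%E by apply: ereal_sup_ubound; exists x.
case: (unorm f) fx_le => [M| |] fx_le; last 2 first.
- by rewrite gt0_muley ?leey// lte_fin.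
- by have := fx_le 0; rewrite leeNy_eq.
have fM t : `|f t| <= M by rewrite -lee_fin.
have M0 : 0 <= M by apply: le_trans (fM 0).
apply: ge_ereal_sup => _ [x _ <-].
apply: ge_ereal_sup => _ [h' /andP[h'0 h'h] <-].
have h'pi : h' <= pi.
  apply: (le_trans h'h); apply: (le_trans (ltW h_lt)).
  by rewrite ler_pdivrMr ?ltr0n// ler_peMr ?pi_ge0// ler1n.
have [g [d [gd g0 d0 ->]]] := W_expansion k x f_cont fM h'0 h'pi.
have B0 : 0 <= 2 * M by rewrite mulr_ge0.
have := alternating_sum_le gd g0 d0 B0 hk.
rewrite -EFinM lee_fin; set S := \sum_(i < k) _ => S_le.
apply: (le_trans (ler_normB _ _)); rewrite normrM (@ger0_norm _ 2)//.
by have := fM x; lra.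
Qed.
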